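(* Let $X$ be a finite set with $|X|\geqslant 2$, and let $\mathcal{I}(X)$ be the symmetric inverse semigroup on $X$. Then the commuting graph $\mathcal{G}(\mathcal{I}(X))$ contains left paths if and only if $|X|\geqslant 3$, in which case the knit degree of $\mathcal{I}(X)$ is equal to $1$.
   Context: The symmetric inverse semigroup $\mathcal{I}(X)$ is the semigroup of all injective partial maps from $X$ to $X$ (including the empty map) under composition of partial maps. Maps are written on the right of their arguments and composed from left to right: $x(\alpha\beta)=(x\alpha)\beta$. The center of a semigroup $S$ is $Z(S)=\{x\in S: xy=yx \text{ for all } y\in S\}$. The commuting graph $\mathcal{G}(S)$ of a finite non-commutative semigroup $S$ is the simple graph with vertex set $S\setminus Z(S)$ in which two distinct vertices $x,y$ are adjacent if and only if $xy=yx$. A left path in $\mathcal{G}(S)$ is a path $x_1-x_2-\cdots-x_n$ in $\mathcal{G}(S)$ (pairwise distinct vertices, consecutive ones adjacent) such that $x_1\neq x_n$ and $x_1x_i=x_nx_i$ for all $i\in\{1,\ldots,n\}$; its length is $n-1$. If $\mathcal{G}(S)$ contains left paths, the knit degree of $S$ is the length of a shortest left path in $\mathcal{G}(S)$. *)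

(* Defs.v *)
From HB Require Import structures.
From mathcomp Require Import all_boot.

Set Implicit Arguments.
Unset Strict Implicit.
Unset Printing Implicit Defensive.

Local Open Scope group_scope.

#[short(type="finSemigroupType")]
HB.structure Definition FinSemigroup := {S of Semigroup S & Finite S}.

Section CommutingGraph.

Variable S : finSemigroupType.

Definition semigroup_center : {set S} := [set x | [forall y, x * y == y * x]].

Definition cvertex : Type := {x : S | x \notin semigroup_center}.

HB.instance Definition _ := SubFinite.on cvertex.

Definition commuting_graph : rel cvertex :=
  [rel x y | (x != y) && (val x * val y == val y * val x)].

Lemma commuting_graph_sym : symmetric commuting_graph.
Proof. by move=> x y; congr (~~ _ && _); apply: eq_sym. Qed.

Lemma commuting_graph_irr : irreflexive commuting_graph.
Proof. by move=> x; rewrite /commuting_graph /= eqxx. Qed.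

(* The sequence x :: p is a left path; its length, counted in edges, is size p. *)
Definition left_path (x : cvertex) (p : seq cvertex) : bool :=
  [&& path commuting_graph x p, uniq (x :: p), x != last x p &
      all (fun z => val x * val z == val (last x p) * val z) (x :: p)].

Definition contains_left_paths : Prop := exists x p, left_path x p.

Definition is_knit_degree (d : nat) : Prop :=
  (exists x p, left_path x p /\ size p = d) /\
  (forall x p, left_path x p -> d <= size p).

End CommutingGraph.

Section SymmetricInverseSemigroup.

Variable X : finType.

(* A partial map from X to X is a total map to option X, with f x = None when
   x lies outside the domain. *)
Definition partial_injective (f : {ffun X -> option X}) : bool :=
  [forall x, forall y, (f x != None) && (f x == f y) ==> (x == y)].

Record sym_inv : Type := SymInv {
  sym_inv_fun :> {ffun X -> option X};
  sym_inv_inj : partial_injective sym_inv_fun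
}.

HB.instance Definition _ := [isSub for sym_inv_fun].
HB.instance Definition _ := [Finite of sym_inv by <:].

(* Left-to-right composition: first a, then b. *)
Definition sym_inv_comp (a b : sym_inv) : {ffun X -> option X} :=
  [ffun x => obind b (a x)].

Lemma sym_inv_comp_inj a b : partial_injective (sym_inv_comp a b).
Proof.
apply/forallP => x; apply/forallP => y; apply/implyP; rewrite !ffunE.
case ax: (a x) => [u|//]; case ay: (a y) => [v|] /= /andP[bu /eqP buv]; last first.
  by rewrite buv in bu.
have /forallP/(_ u)/forallP/(_ v)/implyP := sym_inv_inj b.
rewrite bu buv eqxx => /(_ isT)/eqP uv.
have /forallP/(_ x)/forallP/(_ y)/implyP := sym_inv_inj a.
by apply; rewrite ax ay uv eqxx.
Qed.

Definition sym_inv_mul (a b : sym_inv) : sym_inv :=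
  SymInv (sym_inv_comp_inj a b).

Lemma sym_inv_mulA : associative sym_inv_mul.
Proof.
move=> a b c; apply/val_inj/ffunP => x; rewrite /= !ffunE /=.
by case: (a x) => [u|] //=; rewrite !ffunE.
Qed.

HB.instance Definition _ := isSemigroup.Build sym_inv sym_inv_mulA.

End SymmetricInverseSemigroup.

(* Main.v *)
(** If [a], [b], [c] are distinct, the rank one maps a -> b and a -> c are
    noncentral and all four products of the two vanish, which gives a left path
    of length 1.  If |X| = 2, the only adjacent vertices are the two idempotents
    of rank one, so the ends x and y of a left path are idempotents; idempotent
    partial injections commute, hence x = x x = y x = x y = y y = y. *)

Require Import Defs.
From mathcomp Require Import all_boot.

Set Implicit Arguments.
Unset Strict Implicit.
Unset Printing Implicit Defensive.

Section SymInvTheory.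

Local Open Scope group_scope.

Variable X : finType.
Implicit Types (f g : sym_inv X) (a b c x y : X).

Lemma sym_invP f g : (forall x, f x = g x) -> f = g.
Proof. by move=> fg; apply/val_inj/ffunP. Qed.

Lemma sym_inv_mulE f g x : (f * g) x = obind g (f x).
Proof. by rewrite /= ffunE. Qed.

Lemma sym_inv_some_inj f x y z : f x = Some z -> f y = Some z -> x = y.
Proof.
move=> fx fy; have /forallP/(_ x)/forallP/(_ y)/implyP := sym_inv_inj f.
by rewrite fx fy eqxx => /(_ isT)/eqP.
Qed.

(** Evaluating [f * f = f] at [x] shows that [f] also sends [y] to [y], so [x] and [y] share a value
    and injectivity identifies them: idempotents are partial identities. *)
Lemma sym_inv_idem_fix f x y : f * f = f -> f x = Some y -> y = x.
Proof.
move=> ff fx; apply: (@sym_inv_some_inj f _ _ y) => //.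
by have := sym_inv_mulE f f x; rewrite ff fx => /esym.
Qed.

(** Both products are the partial identity on the intersection of the two domains. *)
Lemma sym_inv_idem_comm f g : f * f = f -> g * g = g -> f * g = g * f.
Proof.
move=> ff gg; apply: sym_invP => x; rewrite !sym_inv_mulE.
case fx: (f x) => [y|]; case gx: (g x) => [z|] //=.
- have yx := sym_inv_idem_fix ff fx; have zx := sym_inv_idem_fix gg gx.
  by rewrite yx zx fx gx yx zx.
- by rewrite (sym_inv_idem_fix ff fx).
- by rewrite (sym_inv_idem_fix gg gx).
Qed.

Lemma sym_inv_zero_central f :
  (forall x, f x = None) -> f \in semigroup_center (sym_inv X).
Proof.
move=> f0; rewrite inE; apply/forallP => g; apply/eqP/sym_invP => x.
by rewrite !sym_inv_mulE f0; case: (g x) => //= y; rewrite f0.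
Qed.

Lemma sym_inv_one_central f :
  (forall x, f x = Some x) -> f \in semigroup_center (sym_inv X).
Proof.
move=> f1; rewrite inE; apply/forallP => g; apply/eqP/sym_invP => x.
by rewrite !sym_inv_mulE f1 /=; case: (g x) => //= y; rewrite f1.
Qed.

Lemma single_map_inj a b :
  partial_injective [ffun x => if x == a then Some b else None].
Proof.
apply/forallP => x; apply/forallP => y; apply/implyP; rewrite !ffunE.
by case: (x =P a) => [->|//]; case: (y =P a) => [->|//]; rewrite eqxx.
Qed.

Definition single_map a b : sym_inv X := SymInv (single_map_inj a b).

Lemma single_mapE a b x : single_map a b x = if x == a then Some b else None.
Proof. by rewrite ffunE. Qed.

Lemma single_map_mul0 a b c d x :
  b != c -> (single_map a b * single_map c d) x = None.
Proof.
move=> /negPf bc; rewrite sym_inv_mulE single_mapE.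
by case: eqP => //= _; rewrite ffunE bc.
Qed.

Lemma single_map_noncentral a b :
  a != b -> single_map a b \notin semigroup_center (sym_inv X).
Proof.
(* Following a -> b by b -> b gives a -> b again, whereas the opposite product is undefined at
   [a]. *)
move=> ab; rewrite inE; apply/forallPn; exists (single_map b b).
apply/eqP => /(congr1 (fun f : sym_inv X => f a)).
by rewrite !sym_inv_mulE !single_mapE eqxx (negPf ab) /= single_mapE eqxx.
Qed.

(** Of the seven partial injections on two points, the empty map and the identity are central. The
    swap, a -> b and b -> a each commute with no other vertex, which leaves only the idempotents a
    -> a and b -> b. *)
Lemma adjacent_idem_card2 (u v : cvertex (sym_inv X)) :
  #|X| = 2 -> commuting_graph u v -> val u * val u = val u.
Proof.
rewrite -cardsT => /eqP/cards2P[a [b [ab XE]]].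
have Xab x : x = a \/ x = b.
  by have := in_setT x; rewrite XE !inE => /orP[] /eqP; [left | right].
have Oab (o : option X) : [\/ o = None, o = Some a | o = Some b].
  by case: o => [x|]; [case: (Xab x) => ->; [apply: Or32 | apply: Or33] | apply: Or31].
have extab (f g : sym_inv X) : f a = g a -> f b = g b -> f = g.
  by move=> fa fb; apply: sym_invP => x; case: (Xab x) => ->.
case: u v => [f nf] [g ng] /andP[/= fg /eqP comm].
have {}fg : f <> g by move=> E; case/eqP: fg; apply: val_inj.
have noncentral (h : sym_inv X) : h \notin semigroup_center (sym_inv X) ->
    ~ (h a = None /\ h b = None) /\ ~ (h a = Some a /\ h b = Some b).
  move/negP=> nh; split=> -[ha hb]; apply: nh.
    by apply: sym_inv_zero_central => x; case: (Xab x) => ->.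
  by apply: sym_inv_one_central => x; case: (Xab x) => ->.
have [f0 f1] := noncentral _ nf; have [g0 g1] := noncentral _ ng.
have ca := congr1 (fun h : sym_inv X => h a) comm.
have cb := congr1 (fun h : sym_inv X => h b) comm.
rewrite !sym_inv_mulE in ca cb.
have ifab (h : sym_inv X) x : h a = Some x -> h b = Some x -> False.
  by move=> ha /(sym_inv_some_inj ha)/eqP; rewrite (negPf ab).
(* Of the nine pairs of values at [a] and [b], centrality discards two and injectivity two more; the
   choices with [g] equal to [f] are discarded as well. *)
case: (Oab (f a)) => fa; case: (Oab (f b)) => fb;
  try first [by case: f0 | by case: f1 | by case: (ifab _ _ fa fb)];
  case: (Oab (g a)) => ga; case: (Oab (g b)) => gb;
  try first [by case: g0 | by case: g1 | by case: (ifab _ _ ga gb)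
      | by case: fg; apply: extab; rewrite ?(fa, fb, ga, gb)].
all: try by apply: extab; rewrite sym_inv_mulE ?(fa, fb) /= ?(fa, fb).
(* Here [f] is the swap, a -> b or b -> a. At [a] or at [b] one of the two products is defined and
   the other is not, against commutation. *)
all: move: ca cb; rewrite fa fb ga gb /= ?(fa, fb, ga, gb) //.
Qed.

End SymInvTheory.

(** A path without edges has equal ends. This is the lower bound for the knit degree. *)
Lemma left_path_size_gt0 (S : finSemigroupType) (x : cvertex S) p :
  left_path x p -> 0 < size p.
Proof. by case: p => [|y p] //; case/and4P; rewrite eqxx. Qed.

(** The first and last edges provide the neighbours of the ends, and the two equations are the left
    path condition at the ends themselves. *)
Lemma left_path_ends (S : finSemigroupType) (x : cvertex S) p :
  left_path x p ->
  let y := last x p in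
  [/\ exists z, commuting_graph x z, exists z, commuting_graph y z, x != y,
      (val x * val x = val y * val x)%g & (val x * val y = val y * val y)%g].
Proof.
move=> lp; have := left_path_size_gt0 lp; case/and4P: lp => xp _ xy /allP eqm p0.
split=> //; last 2 first.
- exact/eqP/eqm/mem_head.
- exact/eqP/eqm/mem_last.
- by case: p p0 xp {xy eqm} => //= z p _ /andP[xz _]; exists z.
- case/lastP: p p0 xp {xy eqm} => // p z _; rewrite rcons_path last_rcons.
  by case/andP=> _; rewrite commuting_graph_sym; exists (last x p).
Qed.

Lemma card2_no_left_path (X : finType) :
  #|X| = 2 -> ~ contains_left_paths (sym_inv X).
Proof.
move=> X2 [x [p /left_path_ends [[z xz] [t yt] /eqP xy xx yy]]].
have idx := adjacent_idem_card2 X2 xz; have idy := adjacent_idem_card2 X2 yt.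
apply: xy; apply: val_inj.
by rewrite -idx xx -(sym_inv_idem_comm idx idy) yy idy.
Qed.

Lemma card_gt2_left_path1 (X : finType) : 2 < #|X| ->
  exists (x : cvertex (sym_inv X)) p, left_path x p /\ size p = 1.
Proof.
case/card_gt2P => a [b [c [_ [ab bc ca]]]].
have ac : a != c by rewrite eq_sym.
pose x : cvertex (sym_inv X) := exist _ (single_map _ _) (single_map_noncentral ab).
pose y : cvertex (sym_inv X) := exist _ (single_map _ _) (single_map_noncentral ac).
have xy : x != y.
  apply/eqP => /(congr1 (fun v : cvertex (sym_inv X) => val v a)).
  by rewrite /= !ffunE eqxx => -[/eqP]; rewrite (negPf bc).
(* Both sides are the empty map, since [d] and [d'] lie outside the domain of the second factor. The
   instances needed are xy = yx for the edge, and xx = yx and xy = yy for the left path. *)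
have mul0 d d' e e' : d != a -> d' != a ->
    (single_map a d * single_map a e = single_map a d' * single_map a e')%g.
  by move=> da d'a; apply: sym_invP => z; rewrite !single_map_mul0.
exists x, [:: y]; split=> //; rewrite /left_path /commuting_graph /= inE xy /= !andbT.
by apply/and3P; split; apply/eqP/mul0; rewrite // eq_sym.
Qed.

Theorem proposition6p2 (X : finType) (hX : 2 <= #|X|) :
  (contains_left_paths (sym_inv X) <-> 3 <= #|X|) /\
  (3 <= #|X| -> is_knit_degree (sym_inv X) 1).
Proof.
split; last first.
  move=> X3; split; first exact: card_gt2_left_path1.
  by move=> x p; apply: left_path_size_gt0.
split=> [lp | /card_gt2_left_path1[x [p [lp _]]]]; last by exists x, p.
rewrite ltn_neqAle hX andbT eq_sym; apply/eqP => X2.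
exact: (card2_no_left_path X2).
Qed.
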